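(* Let $H_i$ ($i\in\mathbb{N}$) and $H$ be functions $[0,T]\times\mathbb{R}^n\times\mathbb{R}^n\to\mathbb{R}$, each satisfying (H1)–(H4) and (HLC). Let $(\mathbb{R}^{n+1},f_i,l_i)$ and $(\mathbb{R}^{n+1},f,l)$ be the Steiner representations of $H_i$ and $H$ (as defined in the context). If for every $t\in[0,T]$ the functions $H_i(t,\cdot,\cdot)$ converge to $H(t,\cdot,\cdot)$ uniformly on compact subsets of $\mathbb{R}^n\times\mathbb{R}^n$, then for every $t\in[0,T]$, $f_i(t,\cdot,\cdot)\to f(t,\cdot,\cdot)$ and $l_i(t,\cdot,\cdot)\to l(t,\cdot,\cdot)$ uniformly on compact subsets of $\mathbb{R}^n\times\mathbb{R}^{n+1}$.
   Context: Hypotheses on $H:[0,T]\times\mathbb{R}^n\times\mathbb{R}^n\to\mathbb{R}$: (H1) $H(\cdot,x,p)$ Lebesgue measurable; (H2) $H(t,\cdot,\cdot)$ continuous; (H3) $H(t,x,\cdot)$ convex; (H4) there is a measurable $c\ge0$ with $|H(t,x,p)-H(t,x,q)|\le c(t)(1+|x|)|p-q|$; (HLC) for every $R>0$ there is a measurable $k_R\ge0$ with $|H(t,x,p)-H(t,y,p)|\le k_R(t)(1+|p|)|x-y|$ for $x,y\in\bar B_R$ (closed ball of radius $R$ about $0$), all $p$. $H^*(t,x,v)=\sup_p\{\langle v,p\rangle-H(t,x,p)\}$. Steiner representation: $E(t,x)=\mathrm{epi}\,H^*(t,x,\cdot)\subset\mathbb{R}^{n+1}$; $\Phi(t,x,a)=E(t,x)\cap\bar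 B(a,2d(a,E(t,x)))$ for $a\in\mathbb{R}^{n+1}$ ($d$ = Euclidean distance to a set); Steiner point of a nonempty compact convex $K\subset\mathbb{R}^m$: $s_m(K)=m\int_{S^{m-1}}p\,\max_{y\in K}\langle p,y\rangle\,\mu(dp)$, $\mu$ the normalized rotation-invariant measure on the unit sphere; $e(t,x,a)=s_{n+1}(\Phi(t,x,a))=(f(t,x,a),l(t,x,a))$ with $f\in\mathbb{R}^n$, $l\in\mathbb{R}$. *)

(* Defs.v *)
(* MathComp + MathComp-Analysis, over an abstract R : realType. *)
From HB Require Import structures.
From mathcomp Require Import all_boot all_order all_algebra.
From mathcomp Require Import all_classical all_reals all_analysis.
Set Implicit Arguments. Unset Strict Implicit. Unset Printing Implicit Defensive.
Import Order.TTheory GRing.Theory Num.Theory.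
Import numFieldNormedType.Exports.
Local Open Scope classical_set_scope.
Local Open Scope ring_scope.

Section Defs.
Variable R : realType.

(** The real line equipped with the (completed) Lebesgue sigma-algebra:
    the domain type of [completed_lebesgue_measure]. *)
Definition LebR : measurableType _ :=
  caratheodory_type ((wlength (R:=R) idfun)^*)%mu.

(** Euclidean inner product and Euclidean norm on R^m = 'rV[R]_m. *)
Definition dotv (m : nat) (u v : 'rV[R]_m) : R := \sum_(i < m) u 0 i * v 0 i.
Definition enorm (m : nat) (u : 'rV[R]_m) : R := Num.sqrt (dotv u u).

(** Lebesgue integral over R^m, computed as an iterated Lebesgue integral
    (Fubini) of a function of m real variables. *)
Definition ext (m : nat) (x : R) (v : 'I_m -> R) : 'I_m.+1 -> R :=
  fun i => match unlift ord0 i with Some j => v j | None => x end.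

Fixpoint iint (m : nat) : (('I_m -> R) -> R) -> R :=
  match m with
  | 0 => fun F => F (fun _ => 0)
  | m'.+1 => fun F =>
      Rintegral (@lebesgue_measure R) setT (fun x : R => iint (fun v => F (ext x v)))
  end.

(** integral over the closed unit ball of R^m *)
Definition ball_int (m : nat) (g : 'rV[R]_m -> R) : R :=
  iint (fun v => let u := \row_(i < m) v i in
                 if enorm u <= 1 then g u else 0).

(** integral against the normalized rotation-invariant measure mu on S^{m-1}:
    mu(A) = vol({x in B | x/|x| in A}) / vol(B)  (cone construction). *)
Definition sphere_int (m : nat) (g : 'rV[R]_m -> R) : R :=
  ball_int (fun u => g ((enorm u)^-1 *: u)) / ball_int (fun _ : 'rV[R]_m => 1).

(** support function h_K(p) = max_{y in K} <p,y> *)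
Definition support (m : nat) (K : set 'rV[R]_m) (p : 'rV[R]_m) : R :=
  sup [set dotv p y | y in K].

(** Steiner point s_m(K) = m \int_{S^{m-1}} p h_K(p) mu(dp) *)
Definition steiner (m : nat) (K : set 'rV[R]_m) : 'rV[R]_m :=
  \row_(j < m) (m%:R * sphere_int (fun p => p 0 j * support K p)).

(** distance to a set *)
Definition dist_set (m : nat) (a : 'rV[R]_m) (E : set 'rV[R]_m) : R :=
  inf [set enorm (a - y) | y in E].

Variable n : nat.
Implicit Types (H : R -> 'rV[R]_n -> 'rV[R]_n -> R).

Definition firstn (a : 'rV[R]_n.+1) : 'rV[R]_n :=
  \row_(j < n) a 0 (widen_ord (leqnSn n) j).
Definition lastc (a : 'rV[R]_n.+1) : R := a 0 ord_max.

(** Legendre-Fenchel conjugate H^*(t,x,v) = sup_p (<v,p> - H(t,x,p)) *)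
Definition Hstar H (t : R) (x v : 'rV[R]_n) : \bar R :=
  ereal_sup [set ((dotv v p - H t x p)%:E) | p in setT].

(** E(t,x) = epi H^*(t,x,.) in R^{n+1} = R^n x R *)
Definition epiH H (t : R) (x : 'rV[R]_n) : set 'rV[R]_n.+1 :=
  [set a | (Hstar H t x (firstn a) <= (lastc a)%:E)%E].

(** Phi(t,x,a) = E(t,x) cap closed ball(a, 2 d(a,E(t,x))) *)
Definition PhiH H (t : R) (x : 'rV[R]_n) (a : 'rV[R]_n.+1) : set 'rV[R]_n.+1 :=
  [set y | epiH H t x y /\ enorm (y - a) <= 2 * dist_set a (epiH H t x)].

Definition eH H (t : R) (x : 'rV[R]_n) (a : 'rV[R]_n.+1) : 'rV[R]_n.+1 :=
  steiner (PhiH H t x a).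
Definition fH H (t : R) (x : 'rV[R]_n) (a : 'rV[R]_n.+1) : 'rV[R]_n :=
  firstn (eH H t x a).
Definition lH H (t : R) (x : 'rV[R]_n) (a : 'rV[R]_n.+1) : R :=
  lastc (eH H t x a).

(** Hypotheses (H1)-(H4) and (HLC) on [0,T] x R^n x R^n *)
Definition hyp_H1 (T : R) H : Prop :=
  forall x p, measurable_fun (`[0, T] : set LebR) (fun t : LebR => H t x p).
Definition hyp_H2 (T : R) H : Prop :=
  forall t, t \in `[0, T] ->
    continuous (fun xp : 'rV[R]_n * 'rV[R]_n => H t xp.1 xp.2).
Definition hyp_H3 (T : R) H : Prop :=
  forall t, t \in `[0, T] -> forall x p q (lam : R), 0 <= lam <= 1 ->
    H t x (lam *: p + (1 - lam) *: q) <= lam * H t x p + (1 - lam) * H t x q.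
Definition hyp_H4 (T : R) H : Prop :=
  exists c : LebR -> R, measurable_fun (`[0, T] : set LebR) c /\
    forall t, t \in `[0, T] -> 0 <= c t /\
      forall x p q, `|H t x p - H t x q| <= c t * (1 + enorm x) * enorm (p - q).
Definition hyp_HLC (T : R) H : Prop :=
  forall r : R, 0 < r ->
  exists k : LebR -> R, measurable_fun (`[0, T] : set LebR) k /\
    forall t, t \in `[0, T] -> 0 <= k t /\
      forall x y p, enorm x <= r -> enorm y <= r ->
        `|H t x p - H t y p| <= k t * (1 + enorm p) * enorm (x - y).
Definition hyps (T : R) H : Prop :=
  [/\ hyp_H1 T H, hyp_H2 T H, hyp_H3 T H, hyp_H4 T H & hyp_HLC T H].

End Defs.

(* Main.v *)
(* Everything happens at a fixed time [t], for the convex functions [H t x] and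
   [Hs i t x] of the momentum.  If [g] and [g'] are convex and close on a ball of
   large radius [P], then every bounded point of epi g^* is close to a point of
   epi g'^*: convexity turns closeness on the ball into a global lower bound of
   [g' - affine] by [- s |p|] with [s = O(1 / P)], and a sandwich theorem provides
   an affine minorant of [g'] whose slope is off by at most [s].  Hence the
   epigraphs are uniformly Hausdorff-close on bounded sets, and so are their
   intersections with the balls of radius twice the distance, because a point can
   be pulled back into such a ball by moving towards a near-minimizer of the
   distance.  The Steiner point is Lipschitz in the Hausdorff distance, being an
   integral of the support function; the measurability needed for the linearity
   of the iterated integral comes from the Lipschitz continuity of that function. *)
Require Import Defs.
From HB Require Import structures.
From mathcomp Require Import all_boot all_order all_algebra.
From mathcomp Require Import all_classical all_reals all_analysis.
From mathcomp Require Import ring lra measurable_realfun.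
Import Order.TTheory GRing.Theory Num.Theory.
Import numFieldNormedType.Exports.
Local Open Scope classical_set_scope.
Local Open Scope ring_scope.


(** * Euclidean inner product and norm, and comparison with the max norm *)

Section Euclidean.
Context {R : realType} {m : nat}.
Implicit Types (u v w : 'rV[R]_m) (a : R).

Lemma dotvC u v : dotv u v = dotv v u.
Proof. by apply: eq_bigr => i _; rewrite mulrC. Qed.

Lemma dotvDl u v w : dotv (u + v) w = dotv u w + dotv v w.
Proof. by rewrite -big_split; apply: eq_bigr => i _; rewrite mxE mulrDl. Qed.

Lemma dotvZl a u v : dotv (a *: u) v = a * dotv u v.
Proof. by rewrite mulr_sumr; apply: eq_bigr => i _; rewrite mxE mulrA. Qed.

Lemma dotvDr u v w : dotv w (u + v) = dotv w u + dotv w v.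
Proof. by rewrite dotvC dotvDl !(dotvC w). Qed.

Lemma dotvZr a u v : dotv u (a *: v) = a * dotv u v.
Proof. by rewrite dotvC dotvZl dotvC. Qed.

Lemma dotvNl u v : dotv (- u) v = - dotv u v.
Proof. by rewrite -scaleN1r dotvZl mulN1r. Qed.

Lemma dotvBr u v w : dotv w (u - v) = dotv w u - dotv w v.
Proof. by rewrite dotvDr !(dotvC w) dotvNl. Qed.

Lemma dotvBl u v w : dotv (u - v) w = dotv u w - dotv v w.
Proof. by rewrite dotvDl dotvNl. Qed.

Lemma dotv0 u : dotv u 0 = 0.
Proof. by rewrite -(scale0r u) dotvZr mul0r. Qed.

Lemma dotv_ge0 u : 0 <= dotv u u.
Proof. by apply: sumr_ge0 => i _; rewrite -expr2 sqr_ge0. Qed.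

Lemma enorm_ge0 u : 0 <= enorm u.
Proof. exact: sqrtr_ge0. Qed.

Lemma sqr_enorm u : enorm u ^+ 2 = dotv u u.
Proof. by rewrite sqr_sqrtr// dotv_ge0. Qed.

Lemma norm_coord_le u i : `|u 0 i| <= enorm u.
Proof.
rewrite -sqrtr_sqr ler_wsqrtr// /dotv (bigD1 i)//= -expr2 lerDl.
by apply: sumr_ge0 => j _; rewrite -expr2 sqr_ge0.
Qed.

Lemma enorm0 : enorm (0 : 'rV[R]_m) = 0.
Proof. by rewrite /enorm dotv0 sqrtr0. Qed.

Lemma enorm_eq0 u : enorm u = 0 -> u = 0.
Proof.
move=> u0; apply/rowP => i; rewrite mxE; apply/eqP.
by rewrite -normr_le0 -u0 norm_coord_le.
Qed.

Lemma enormZ a u : enorm (a *: u) = `|a| * enorm u.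
Proof. by rewrite /enorm dotvZl dotvZr mulrA -expr2 sqrtrM ?sqr_ge0// sqrtr_sqr. Qed.

Lemma enormN u : enorm (- u) = enorm u.
Proof. by rewrite -scaleN1r enormZ normrN1 mul1r. Qed.

Lemma enormB u v : enorm (u - v) = enorm (v - u).
Proof. by rewrite -enormN opprB. Qed.

Lemma le_dotv u v : dotv u v <= enorm u * enorm v.
Proof.
have [u0|u0] := eqVneq (enorm u) 0.
  by rewrite u0 mul0r (enorm_eq0 u u0) dotvC dotv0.
have [v0|v0] := eqVneq (enorm v) 0.
  by rewrite v0 mulr0 (enorm_eq0 v v0) dotv0.
have u_gt0 : 0 < enorm u by rewrite lt_neqAle eq_sym u0 enorm_ge0.
have v_gt0 : 0 < enorm v by rewrite lt_neqAle eq_sym v0 enorm_ge0.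
have := dotv_ge0 (enorm v *: u - enorm u *: v).
rewrite dotvBr !dotvZr !dotvBl !dotvZl -!sqr_enorm (dotvC v u) => h.
suff : 0 <= (enorm u * enorm v) * (enorm u * enorm v - dotv u v) * 2.
  by rewrite pmulr_lge0// pmulr_rge0 ?mulr_gt0// subr_ge0.
by apply: le_trans h _; rewrite le_eqVlt; apply/orP; left; apply/eqP; ring.
Qed.

Lemma enormD u v : enorm (u + v) <= enorm u + enorm v.
Proof.
rewrite -(ler_pXn2r (_ : 0 < 2)%N) ?nnegrE ?addr_ge0 ?enorm_ge0//.
rewrite sqr_enorm dotvDl !dotvDr (dotvC v u) -!sqr_enorm.
have := le_dotv u v; nra.
Qed.

Lemma enorm_le_sum u : enorm u <= \sum_i `|u 0 i|.
Proof.
have s_ge0 : 0 <= \sum_i `|u 0 i| by exact: sumr_ge0.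
rewrite -(ler_pXn2r (_ : 0 < 2)%N) ?nnegrE ?enorm_ge0// sqr_enorm.
rewrite expr2 mulr_suml; apply: ler_sum => i _.
apply: le_trans (ler_norm _) _; rewrite normrM ler_wpM2l//.
by rewrite (bigD1 i)//= lerDl; exact: sumr_ge0.
Qed.

Lemma norm_coord_le_norm u i : `|u 0 i| <= `|u|.
Proof.
rewrite [leRHS]/Num.norm/= mx_normrE.
by apply/bigmax_geP; right; exists (0, i).
Qed.

Lemma norm_le_enorm u : `|u| <= enorm u.
Proof.
rewrite [leLHS]/Num.norm/= mx_normrE; apply/bigmax_leP; split.
  exact: enorm_ge0.
by move=> [i j] _ /=; rewrite ord1 norm_coord_le.
Qed.

Lemma enorm_le_norm u : enorm u <= m%:R * `|u|.
Proof.
apply: le_trans (enorm_le_sum u) _.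
rewrite (_ : m%:R * `|u| = \sum_(i < m) `|u|).
  by apply: ler_sum => i _; exact: norm_coord_le_norm.
by rewrite sumr_const card_ord mulr_natl.
Qed.

End Euclidean.

Lemma dotv_row_mx (R : realType) m k (u1 v1 : 'rV[R]_m) (u2 v2 : 'rV[R]_k) :
  dotv (row_mx u1 u2) (row_mx v1 v2) = dotv u1 v1 + dotv u2 v2.
Proof.
rewrite /dotv big_split_ord; congr (_ + _);
  by apply: eq_bigr => i _; rewrite ?row_mxEl ?row_mxEr.
Qed.

(** * Existence of subgradients for finite convex functions *)

Section Convex.
Context {R : realType}.

Definition convexf {m} (G : 'rV[R]_m -> R) := forall p q (l : R), 0 <= l <= 1 ->
  G (l *: p + (1 - l) *: q) <= l * G p + (1 - l) * G q.

(** Convexity at [0], seen as a combination of [x > 0] and [- y < 0], puts every left secant slope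
    below every right one. The supremum of the left slopes separates the two families. *)
Lemma subgradient_real (G : R -> R) :
  (forall x y l, 0 <= l <= 1 -> G (l * x + (1 - l) * y) <= l * G x + (1 - l) * G y) ->
  exists a, forall x, G 0 + a * x <= G x.
Proof.
move=> cG.
have slope x y : 0 < x -> 0 < y -> (G 0 - G (- y)) / y <= (G x - G 0) / x.
  move=> x0 y0.
  have xy0 : 0 < x + y by lra.
  have /(cG x (- y)) : 0 <= y / (x + y) <= 1.
    by apply/andP; split; [rewrite divr_ge0 ?ltW | rewrite ler_pdivrMr// mul1r; lra].
  have -> : y / (x + y) * x + (1 - y / (x + y)) * - y = 0 by field; rewrite gt_eqF.
  have -> : y / (x + y) * G x + (1 - y / (x + y)) * G (- y)
      = (y * G x + x * G (- y)) / (x + y) by field; rewrite gt_eqF.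
  rewrite ler_pdivlMr// => h.
  by rewrite ler_pdivrMr// mulrAC ler_pdivlMr//; lra.
pose S := [set (G 0 - G (- y)) / y | y in [set y | 0 < y]].
have S0 : S !=set0 by exists ((G 0 - G (- 1)) / 1); exists 1; rewrite /= ?ltr01.
have Sub x : 0 < x -> ubound S ((G x - G 0) / x).
  by move=> x0 _ [y y0 <-]; exact: slope.
have supS : has_sup S by split=> //; exists ((G 1 - G 0) / 1); apply: Sub.
exists (sup S) => x; have [x0|x0|->] := ltrgtP x 0.
- have : S ((G 0 - G (- (- x))) / (- x)) by exists (- x); rewrite /= ?oppr_gt0.
  move=> /(ub_le_sup supS.2); rewrite opprK ler_pdivrMr ?oppr_gt0//; lra.
- have := ge_sup S0 (Sub x x0); rewrite ler_pdivlMr//; lra.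
- by rewrite mulr0 addr0.
Qed.

(* Induction on the dimension: after subtracting a subgradient along the first
   coordinate, minimize over that coordinate. *)
Lemma subgradient m (G : 'rV[R]_m -> R) : convexf G ->
  exists w, forall p, G 0 + dotv w p <= G p.
Proof.
elim: m G => [|m IH] G cG.
  by exists 0 => p; rewrite (thinmx0 p) dotv0 addr0.
pose r (x : R) (p : 'rV[R]_m) : 'rV[R]_(1 + m) := row_mx x%:M p.
have rE x p y q l : r (l * x + (1 - l) * y) (l *: p + (1 - l) *: q)
    = l *: r x p + (1 - l) *: r y q.
  rewrite /r !scale_row_mx add_row_mx; congr row_mx.
  by apply/matrixP => i j; rewrite !ord1 !mxE eqxx !mulr1n.
have r00 : r 0 0 = 0 :> 'rV_(1 + m) by rewrite /r raddf0 row_mx0.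
have [a Ha] : exists a, forall x, G (r 0 0) + a * x <= G (r x 0).
  apply: (@subgradient_real (fun x => G (r x 0))) => x y l l01.
  by have := cG (r x 0) (r y 0) l l01; rewrite -rE !scaler0 addr0.
pose M p := inf [set G (r x p) - a * x | x in setT].
(* The midpoint of [r x p] and [r y (- p)] lies on the first axis, where [Ha] applies. With [y]
   fixed this bounds [G (r x p) - a * x] below, so the infimum [M p] is finite. *)
have mid x y p : G (r 0 0) - (G (r y (- p)) - a * y) <= G (r x p) - a * x - G (r 0 0).
  have h : 0 <= (2^-1 : R) <= 1 by lra.
  have := cG (r x p) (r y (- p)) _ h; rewrite -rE.
  have -> : 2^-1 *: p + (1 - 2^-1) *: - p = 0 :> 'rV[R]_m.
    by rewrite scalerN -scalerBl (_ : _ - _ = 0) ?scale0r//; lra.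
  have := Ha (2^-1 * x + (1 - 2^-1) * y); lra.
have infM p : has_inf [set G (r x p) - a * x | x in setT].
  split; first by exists (G (r 0 p) - a * 0); exists 0.
  exists (G (r 0 0) - (G (r 0 (- p)) - a * 0) + G (r 0 0)) => _ [x _ <-].
  have := mid x 0 p; lra.
(* Partial minimization of a jointly convex function is convex: combine near-minimizers over [p] and
   over [q]. *)
have cM : convexf M.
  move=> p q l l01; apply/ler_addgt0Pr => e e0.
  have [_ [x _ <-] xe] := inf_adherent e0 (infM p).
  have [_ [y _ <-] ye] := inf_adherent e0 (infM q).
  have : M (l *: p + (1 - l) *: q)
      <= G (r (l * x + (1 - l) * y) (l *: p + (1 - l) *: q)) - a * (l * x + (1 - l) * y).
    by apply: (ge_inf (infM _).2); exists (l * x + (1 - l) * y).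
  rewrite rE => h; have := cG (r x p) (r y q) l l01; rewrite -/(M p) -/(M q) in xe ye.
  have /andP[l0 l1] := l01.
  have : l * (G (r x p) - a * x) <= l * (M p + e) by rewrite ler_wpM2l// ltW.
  have : (1 - l) * (G (r y q) - a * y) <= (1 - l) * (M q + e) by rewrite ler_wpM2l ?subr_ge0// ltW.
  move: h; nra.
have M0 : G 0 <= M 0.
  apply: lb_le_inf; first exact: (infM 0).1.
  by move=> _ [x _ <-]; have := Ha x; rewrite r00; lra.
have [w Hw] := IH _ cM.
exists (r a w) => p.
have -> : p = r (p 0 0) (rsubmx (p : 'rV_(1 + m))).
  rewrite (_ : p 0 0 = lsubmx (p : 'rV_(1 + m)) 0 0).
    by rewrite /r -mx11_scalar hsubmxK.
  by rewrite mxE; congr (p _ _); apply/val_inj.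
move: (p 0 0) (rsubmx _) => x q.
have -> : dotv (r a w : 'rV_m.+1) (r x q : 'rV_m.+1) = a * x + dotv w q.
  transitivity (dotv (a%:M : 'rV[R]_1) x%:M + dotv w q); first exact: (dotv_row_mx R 1 m a%:M x%:M w q).
  by rewrite /dotv big_ord1 !mxE eqxx !mulr1n.
have := Hw q; have : M q <= G (r x q) - a * x by apply: (ge_inf (infM _).2); exists x.
lra.
Qed.

End Convex.


(** * Linear minorants with a bound on the slope *)

Section Conjugate.
Context {R : realType} {m : nat}.
Implicit Types (G g : 'rV[R]_m -> R) (p q w : 'rV[R]_m).

(* [w] is a subgradient at [0] of the infimal convolution of [G] and [s * enorm]. *)
Lemma sandwich_linear G (s : R) : convexf G -> 0 <= s ->
  (forall p, - s * enorm p <= G p) ->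
  exists2 w, enorm w <= s & forall p, dotv w p <= G p.
Proof.
move=> cG s0 Gs.
pose S p := [set G u + s * enorm (p - u) | u in setT].
pose N p := inf (S p).
have lbS p : lbound (S p) (- s * enorm p).
  move=> _ [u _ <-]; have := Gs u; have := enormD p (u - p).
  rewrite addrC subrK (enormB u p); nra.
have infS p : has_inf (S p).
  by split; [exists (G 0 + s * enorm (p - 0)), 0 | exists (- s * enorm p)].
have leN p u : N p <= G u + s * enorm (p - u).
  by apply: (ge_inf (infS p).2); exists u.
have N0 : 0 <= N 0.
  by have := lb_le_inf (infS 0).1 (lbS 0); rewrite enorm0 mulr0.
have cN : convexf N.
  move=> p q l l01; apply/ler_addgt0Pr => e e0.
  have [_ [u _ <-] ue] := inf_adherent e0 (infS p).
  have [_ [v _ <-] ve] := inf_adherent e0 (infS q).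
  rewrite -/(N p) -/(N q) in ue ve.
  have /andP[l0 l1] := l01.
  have := leN (l *: p + (1 - l) *: q) (l *: u + (1 - l) *: v).
  have := cG u v l l01.
  have := enormD (l *: (p - u)) ((1 - l) *: (q - v)).
  rewrite !enormZ !ger0_norm ?subr_ge0//.
  rewrite (_ : l *: (p - u) + _ = l *: p + (1 - l) *: q - (l *: u + (1 - l) *: v)); last first.
    by rewrite !scalerBr addrACA opprD.
  set E1 := enorm (_ - _ : 'rV_m).
  set E2 := enorm (p - u) in ue *; set E3 := enorm (q - v) in ve * => h1 h2 h3.
  have : l * (G u + s * E2) <= l * (N p + e) by rewrite ler_wpM2l// ltW.
  have : (1 - l) * (G v + s * E3) <= (1 - l) * (N q + e) by rewrite ler_wpM2l ?subr_ge0// ltW.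
  have : s * E1 <= s * (l * E2 + (1 - l) * E3) by rewrite ler_wpM2l.
  nra.
have [w Hw] := subgradient _ _ cN.
exists w => [|p]; last first.
  by have := Hw p; have := leN p p; rewrite subrr enorm0; lra.
rewrite leNgt; apply/negP => sw.
have w0 : 0 < enorm w by apply: le_lt_trans sw.
have k0 : 0 < enorm w * (enorm w - s) by rewrite mulr_gt0// subr_gt0.
(* Along the ray of [w], the subgradient inequality and [N (k *: w) <= G 0 + s * k * enorm w] give
   [k * enorm w * (enorm w - s) <= G 0]. This [k] makes the left side [|G 0| + 1]. *)
pose k := (`|G 0| + 1) / (enorm w * (enorm w - s)).
have kp : 0 < k by rewrite divr_gt0// ltr_pwDr.
have := Hw (k *: w); have := leN (k *: w) 0.
rewrite subr0 enormZ dotvZr -sqr_enorm gtr0_norm//.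
have : k * (enorm w * (enorm w - s)) = `|G 0| + 1 by rewrite divfK// gt_eqF.
have := ler_norm (G 0); nra.
Qed.

End Conjugate.

(** * Epigraphs of conjugates and their stability *)

Section Epigraph.
Context {R : realType} {n : nat}.
Implicit Types (g : 'rV[R]_n -> R) (a y z : 'rV[R]_n.+1).

(** A point [(v, b)] of the epigraph is an affine minorant [p -> <v, p> - b] of [g]. In this form
    the epigraph is an intersection of closed half-spaces, described by real inequalities only. *)
Definition epi_conj g : set 'rV[R]_n.+1 :=
  [set a | forall p, dotv (firstn a) p - g p <= lastc a].

Lemma epiHE (H : R -> 'rV[R]_n -> 'rV[R]_n -> R) t x :
  epiH H t x = epi_conj (H t x).
Proof.
apply/seteqP; split => [a Ha p|a Ha]; rewrite /epiH/=.
  by rewrite -lee_fin; apply: le_trans Ha; apply: ereal_sup_ubound; exists p.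
by apply: ge_ereal_sup => _ [p _ <-]; rewrite lee_fin.
Qed.

Definition pairv (v : 'rV[R]_n) (b : R) : 'rV[R]_n.+1 :=
  \row_j if unlift ord_max j is Some i then v 0 i else b.

Lemma firstn_pairv v b : firstn (pairv v b) = v.
Proof.
apply/rowP => j; rewrite !mxE.
have -> : widen_ord (leqnSn n) j = lift ord_max j.
  exact/val_inj/esym/lift_max.
by rewrite liftK.
Qed.

Lemma lastc_pairv v b : lastc (pairv v b) = b.
Proof. by rewrite /lastc mxE unlift_none. Qed.

Lemma firstnD a y : firstn (a + y) = firstn a + firstn y.
Proof. by apply/rowP => j; rewrite !mxE. Qed.

Lemma firstnZ k y : firstn (k *: y) = k *: firstn y.
Proof. by apply/rowP => j; rewrite !mxE. Qed.

Lemma firstnB a y : firstn (a - y) = firstn a - firstn y.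
Proof. by rewrite -[- y]scaleN1r firstnD firstnZ scaleN1r. Qed.

Lemma lastcB a y : lastc (a - y) = lastc a - lastc y.
Proof. by rewrite /lastc !mxE. Qed.

Lemma sqr_enorm_split y : enorm y ^+ 2 = enorm (firstn y) ^+ 2 + lastc y ^+ 2.
Proof.
rewrite !sqr_enorm /dotv big_ord_recr/= -expr2; congr (_ + _).
by apply: eq_bigr => i _; rewrite !mxE.
Qed.

Lemma enorm_firstn_le y : enorm (firstn y) <= enorm y.
Proof.
rewrite -(ler_pXn2r (_ : 0 < 2)%N) ?nnegrE ?enorm_ge0//.
by rewrite (sqr_enorm_split y) lerDl sqr_ge0.
Qed.

Lemma norm_lastc_le y : `|lastc y| <= enorm y.
Proof. exact: norm_coord_le. Qed.

Lemma enorm_le_split y : enorm y <= enorm (firstn y) + `|lastc y|.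
Proof.
rewrite -(ler_pXn2r (_ : 0 < 2)%N) ?nnegrE ?addr_ge0 ?enorm_ge0//.
rewrite sqr_enorm_split sqrrD -(real_normK (num_real (lastc y))).
have : 0 <= enorm (firstn y) * `|lastc y| by rewrite mulr_ge0 ?enorm_ge0.
lra.
Qed.

Lemma epi_conj_convex g y z (l : R) : 0 <= l <= 1 ->
  epi_conj g y -> epi_conj g z -> epi_conj g (l *: y + (1 - l) *: z).
Proof.
move=> /andP[l0 l1] Ey Ez p.
rewrite firstnD !firstnZ dotvDl !dotvZl /lastc !mxE -!/(lastc _).
have : l * (dotv (firstn y) p - g p) <= l * lastc y by rewrite ler_wpM2l.
have : (1 - l) * (dotv (firstn z) p - g p) <= (1 - l) * lastc z.
  by rewrite ler_wpM2l// subr_ge0.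
rewrite /lastc; lra.
Qed.

(** This is closedness of the epigraph: a point of it within [e / (enorm p + 1)] of [a] violates the
    half-space inequality of [p] at [a] by at most [e]. *)
Lemma epi_conj_dist0 g a : epi_conj g !=set0 -> dist_set a (epi_conj g) = 0 ->
  epi_conj g a.
Proof.
move=> E0 d0 p; apply/ler_addgt0Pr => e e0.
have k0 : 0 < enorm p + 1 by rewrite ltr_wpDl// enorm_ge0.
have hi : has_inf [set enorm (a - y) | y in epi_conj g].
  split; first by case: E0 => y Ey; exists (enorm (a - y)), y.
  by exists 0 => _ [y _ <-]; exact: enorm_ge0.
have [_ [y Ey <-]] := inf_adherent (divr_gt0 e0 k0) hi.
rewrite -/(dist_set a (epi_conj g)) d0 add0r ltr_pdivlMr// => h.
have := Ey p; have := le_dotv (firstn (a - y)) p.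
have := enorm_firstn_le (a - y); have := norm_lastc_le (a - y).
rewrite lastcB firstnB dotvBl ler_norml => /andP[h1 h2] h3 h4 h5.
have : enorm (firstn a - firstn y) * enorm p <= enorm (a - y) * enorm p.
  by rewrite ler_wpM2r// enorm_ge0.
lra.
Qed.

(* If [g'] is close to [g] on the ball of radius [P], then [g' - y + e] is
   nonnegative there, and convexity propagates this to the lower bound
   [- s * enorm p] everywhere with [s] of order [1 / P]; tilting the affine
   minorant [y] by a slope at most [s] therefore makes it a minorant of [g']. *)
Lemma epi_conj_approx g g' (P e rho M : R) y :
  convexf g' -> 0 < P -> 0 <= e -> g' 0 <= M ->
  (forall p, enorm p <= P -> g p <= g' p + e) ->
  epi_conj g y -> enorm y <= rho ->
  exists2 y', epi_conj g' y' & enorm (y' - y) <= (M + rho + e) / P + e.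
Proof.
move=> cg P0 e0 gM gg' Ey yrho.
pose G p := g' p - dotv (firstn y) p + lastc y + e.
have cG : convexf G.
  move=> p q l l01; have := cg p q l l01.
  by rewrite /G dotvDr !dotvZr; nra.
have GP p : enorm p <= P -> 0 <= G p.
  by move=> /gg' h; have := Ey p; rewrite /G; lra.
have G0M : G 0 <= M + rho + e.
  by have := norm_lastc_le y; rewrite ler_norml /G dotv0 => /andP[h1 h2]; lra.
have G0 : 0 <= G 0 by apply: GP; rewrite enorm0 ltW.
have s0 : 0 <= (M + rho + e) / P by apply: divr_ge0; [exact: le_trans G0M | exact: ltW].
have [|w ws wG] := sandwich_linear G _ cG s0.
  move=> p; have [pP|Pp] := leP (enorm p) P.
    by apply: le_trans (GP _ pP); rewrite mulNr oppr_le0 mulr_ge0// enorm_ge0.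
  have p0 : 0 < enorm p by exact: lt_trans Pp.
  (* Outside the ball, compare with the point of norm [P] on the segment from [0] to [p]: there [G]
     is nonnegative, and convexity gives [P * G p >= - (enorm p - P) * G 0]. *)
  have l01 : 0 <= P / enorm p <= 1.
    by apply/andP; split; [rewrite divr_ge0 ?ltW | rewrite ler_pdivrMr// mul1r ltW].
  have := cG p 0 _ l01; rewrite scaler0 addr0.
  have : 0 <= G ((P / enorm p) *: p).
    by apply: GP; rewrite enormZ normrM normfV !gtr0_norm// divfK// gt_eqF.
  move=> h1 /(le_trans h1) h2.
  have : 0 <= P * G p + (enorm p - P) * G 0.
    have -> : P * G p + (enorm p - P) * G 0
        = enorm p * (P / enorm p * G p + (1 - P / enorm p) * G 0).
      by field; rewrite gt_eqF.
    by rewrite mulr_ge0// ltW.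
  rewrite mulNr mulrAC -mulNr ler_pdivrMr//.
  have : (enorm p - P) * G 0 <= enorm p * (M + rho + e).
    by apply: ler_pM => //; [rewrite subr_ge0 ltW | rewrite gerBl ltW].
  lra.
exists (pairv (firstn y + w) (lastc y + e)).
  by move=> p; rewrite firstn_pairv lastc_pairv dotvDl; have := wG p; rewrite /G; lra.
apply: le_trans (enorm_le_split _) _.
rewrite firstnB lastcB firstn_pairv lastc_pairv addrAC subrr add0r addrAC subrr add0r.
by rewrite (ger0_norm e0) lerD2r.
Qed.

End Epigraph.

(** * Intersections with balls of twice the distance, and support functions *)

Section Truncation.
Context {R : realType} {m : nat}.
Implicit Types (E : set 'rV[R]_m) (a p q y z : 'rV[R]_m).

Definition truncate E a := [set y | E y /\ enorm (y - a) <= 2 * dist_set a E].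

Lemma has_inf_dist E a : E !=set0 -> has_inf [set enorm (a - y) | y in E].
Proof.
case=> y Ey; split; first by exists (enorm (a - y)), y.
by exists 0 => _ [z _ <-]; exact: enorm_ge0.
Qed.

Lemma dist_set_le E a y : E y -> dist_set a E <= enorm (a - y).
Proof.
move=> Ey; apply: ge_inf; last by exists y.
by apply: (has_inf_dist E a _).2; exists y.
Qed.

Lemma dist_set_ge0 E a : E !=set0 -> 0 <= dist_set a E.
Proof.
move=> /(has_inf_dist E a)[E0 _]; apply: lb_le_inf => // _ [y _ <-].
exact: enorm_ge0.
Qed.

(** The factor 3/2 lies strictly below the factor 2 of [truncate], which leaves room for pulling
    points back. At distance zero there is no room, and [a] itself is the minimizer. *)
Lemma near_minimizer E a : E !=set0 -> (dist_set a E = 0 -> E a) ->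
  exists2 z, E z & enorm (z - a) <= 3 / 2 * dist_set a E.
Proof.
move=> E0 clE; have := dist_set_ge0 E a E0; rewrite le_eqVlt => /predU1P[d0|d0].
  by exists a; [exact: clE | rewrite subrr enorm0 -d0 mulr0].
have d2 : 0 < dist_set a E / 2 by rewrite divr_gt0.
have [_ [z Ez <-]] := inf_adherent d2 (has_inf_dist E a E0).
rewrite -/(dist_set a E) enormB => h; exists z => //; lra.
Qed.

(* Pull the approximation [y] towards a near-minimizer [z] of the distance, just
   enough to re-enter the ball of radius [2 * dist_set a E]. *)
Lemma truncate_approx E a y (dl : R) : E !=set0 -> (dist_set a E = 0 -> E a) ->
  (forall y z l, 0 <= l <= 1 -> E y -> E z -> E (l *: y + (1 - l) *: z)) ->
  0 < dl -> E y -> enorm (y - a) <= 2 * dist_set a E + 3 * dl ->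
  exists2 w, truncate E a w & enorm (w - y) <= 21 * dl.
Proof.
move=> E0 clE cE dl0 Ey ya; have [z Ez za] := near_minimizer E a E0 clE.
move: (dist_set_ge0 E a E0) ya za; rewrite /truncate; set d := dist_set a E.
move=> d0 ya za.
have D0 : 0 < d / 2 + 3 * dl by lra.
(* This weight solves [l * (2 * d + 3 * dl) + (1 - l) * (3 / 2 * d) = 2 * d]. *)
pose l := (d / 2) / (d / 2 + 3 * dl).
have l0 : 0 <= l by rewrite divr_ge0; lra.
have l1E : 1 - l = 3 * dl / (d / 2 + 3 * dl) by rewrite /l; field; lra.
have l1 : 0 <= 1 - l by rewrite l1E divr_ge0; lra.
exists (l *: y + (1 - l) *: z).
  split; first by apply: cE => //; lra.
  have -> : l *: y + (1 - l) *: z - a = l *: (y - a) + (1 - l) *: (z - a).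
    rewrite !scalerBr addrACA; congr (_ + _).
    by rewrite -opprD -scalerDl addrC subrK scale1r.
  apply: le_trans (enormD _ _) _; rewrite !enormZ !ger0_norm//.
  have : l * enorm (y - a) <= l * (2 * d + 3 * dl) by rewrite ler_wpM2l.
  have : (1 - l) * enorm (z - a) <= (1 - l) * (3 / 2 * d) by rewrite ler_wpM2l.
  have : l * (2 * d + 3 * dl) + (1 - l) * (3 / 2 * d) = 2 * d.
    by rewrite l1E /l; field; lra.
  lra.
have -> : l *: y + (1 - l) *: z - y = (1 - l) *: ((z - a) - (y - a)).
  rewrite opprB addrA subrK scalerBr [LHS]addrAC addrC; congr (_ + _).
  by rewrite scalerBl scale1r opprB.
rewrite enormZ ger0_norm//.
(* The sum of the two radii is [7 / 2 * d + 3 * dl]. Rounding it up to a multiple of the denominator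
   of [1 - l] makes the final bound independent of [d]. *)
have h : enorm (z - a - (y - a)) <= 7 * (d / 2 + 3 * dl).
  by have := enormD (z - a) (- (y - a)); rewrite enormN; lra.
have : (1 - l) * enorm (z - a - (y - a)) <= (1 - l) * (7 * (d / 2 + 3 * dl)).
  by rewrite ler_wpM2l.
have -> : (1 - l) * (7 * (d / 2 + 3 * dl)) = 21 * dl by rewrite l1E; field; lra.
by [].
Qed.

Lemma support_has_sup E p (rho : R) : E !=set0 ->
  (forall y, E y -> enorm y <= rho) -> has_sup [set dotv p y | y in E].
Proof.
move=> [y Ey] Er; split; first by exists (dotv p y), y.
exists (enorm p * rho) => _ [z Ez <-].
by apply: le_trans (le_dotv _ _) _; rewrite ler_wpM2l ?enorm_ge0 ?Er.
Qed.

Lemma support_le E E' p (D rho : R) : E !=set0 ->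
  (forall y, E' y -> enorm y <= rho) ->
  (forall y, E y -> exists2 w, E' w & enorm (w - y) <= D) ->
  Defs.support E p <= Defs.support E' p + D * enorm p.
Proof.
move=> E0 E'r EE'; apply: ge_sup; first by case: E0 => y Ey; exists (dotv p y), y.
move=> _ [y Ey <-]; have [w E'w wy] := EE' _ Ey.
have E'0 : E' !=set0 by exists w.
have : dotv p w <= Defs.support E' p.
  by apply: (ub_le_sup (support_has_sup _ p _ E'0 E'r).2); exists w.
have := le_dotv p (y - w); rewrite dotvBr (enormB y).
have : enorm p * enorm (w - y) <= enorm p * D by rewrite ler_wpM2l ?enorm_ge0.
lra.
Qed.

Lemma support_lipschitz E p q (rho : R) : E !=set0 ->
  (forall y, E y -> enorm y <= rho) ->
  Defs.support E p <= Defs.support E q + rho * enorm (p - q).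
Proof.
move=> E0 Er; apply: ge_sup; first by case: E0 => y Ey; exists (dotv p y), y.
move=> _ [y Ey <-].
have : dotv q y <= Defs.support E q.
  by apply: (ub_le_sup (support_has_sup _ q _ E0 Er).2); exists y.
have := le_dotv (p - q) y; rewrite dotvBl.
have : enorm (p - q) * enorm y <= enorm (p - q) * rho.
  by rewrite ler_wpM2l ?enorm_ge0 ?Er.
lra.
Qed.

Lemma norm_support_le E p (rho : R) : E !=set0 ->
  (forall y, E y -> enorm y <= rho) -> `|Defs.support E p| <= rho * enorm p.
Proof.
move=> E0 Er.
have s0 : Defs.support E 0 = 0.
  rewrite /Defs.support (_ : [set _ | _ in _] = [set 0]) ?sup1//.
  apply/seteqP; split=> [_ [y _ <-]|_ ->]; first by rewrite dotvC dotv0.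
  by case: E0 => y Ey; exists y => //; rewrite dotvC dotv0.
have := support_lipschitz E p 0 rho E0 Er; have := support_lipschitz E 0 p rho E0 Er.
by rewrite s0 subr0 sub0r enormN ler_norml => h1 h2; apply/andP; split; lra.
Qed.

End Truncation.


(** * Measurability under substitution and of parametric integrals *)

Section CoordMeasurable.
Context {R : realType}.

(* Measurability of [F] jointly in a parameter and in finitely many coordinates,
   expressed through measurable substitutions so that no measurable structure is
   needed on ['I_m -> R]. *)
Definition coord_measurable {d} {T : measurableType d} {m} (F : T -> ('I_m -> R) -> R) :=
  forall d' (T' : measurableType d') (psi : T' -> T) (phi : T' -> 'I_m -> R),
    measurable_fun setT psi -> (forall j, measurable_fun setT (phi ^~ j)) ->
    measurable_fun setT (fun t => F (psi t) (phi t)).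

Lemma measurable_fun_sublevel d (T : measurableType d) (f : T -> R) :
  (forall c, measurable [set t | f t < c]) -> measurable_fun setT f.
Proof.
move=> mf; apply: (measurability _ (RGenInftyO.measurableE R)) => _ [_ [c ->] <-].
rewrite setTI (_ : _ @^-1` _ = [set t | f t < c])//.
Qed.

Lemma measurable_enorm d (T : measurableType d) m (phi : T -> 'rV[R]_m) :
  (forall j, measurable_fun setT (fun t => phi t 0 j)) ->
  measurable_fun setT (fun t => enorm (phi t)).
Proof.
move=> mphi; apply: measurable_fun_sublevel => c.
have [c0|c0] := leP c 0.
  rewrite (_ : [set _ | _] = set0)//; apply/seteqP; split => // t /=.
  by move/lt_le_trans => /(_ _ c0); rewrite ltNge enorm_ge0.
have mdot : measurable_fun setT (fun t => dotv (phi t) (phi t)).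
  by apply: measurable_sum => i; exact: measurable_funM.
have := measurable_fun_ltr mdot (measurable_cst (c ^+ 2)).
move=> /(_ measurableT [set true] I); rewrite setTI.
rewrite (_ : _ @^-1` _ = [set t | enorm (phi t) < c])//.
apply/seteqP; split=> t /=; rewrite -sqr_enorm ltr_pXn2r ?nnegrE ?enorm_ge0 ?ltW//.
Qed.

Lemma rat_approx m (u : 'rV[R]_m) (e : R) : 0 < e ->
  exists q : 'rV[rat]_m, enorm (u - map_mx ratr q) < e.
Proof.
move=> e0; have k0 : 0 < m%:R + 1 :> R by rewrite ltr_wpDl.
have ek0 : 0 < e / (m%:R + 1) by rewrite divr_gt0.
have H j : exists q : rat, `|u 0 j - ratr q| <= e / (m%:R + 1).
  have lt_uj : u 0 j - e / (m%:R + 1) < u 0 j by rewrite gtrBl.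
  have [q] := rat_in_itvoo lt_uj.
  rewrite in_itv/= => /andP[h1 h2]; exists q.
  by rewrite ler_norml; apply/andP; split; lra.
have [f Hf] := choice H.
exists (\row_j f j); apply: le_lt_trans (enorm_le_sum _) _.
apply: (@le_lt_trans _ _ (\sum_(j < m) e / (m%:R + 1))).
  by apply: ler_sum => j _; rewrite !mxE.
rewrite sumr_const card_ord -[ltLHS]mulr_natl mulrA ltr_pdivrMr// mulrC ltr_pM2l//.
by rewrite ltrDl.
Qed.

(* [g u < c] iff [g q + L * |u - q| < c] for some rational vector [q]. *)
Lemma measurable_lipschitz d (T : measurableType d) m (g : 'rV[R]_m -> R) (L : R)
    (phi : T -> 'rV[R]_m) : 0 <= L ->
  (forall p q, g p <= g q + L * enorm (p - q)) ->
  (forall j, measurable_fun setT (fun t => phi t 0 j)) ->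
  measurable_fun setT (fun t => g (phi t)).
Proof.
move=> L0 Lg mphi; apply: measurable_fun_sublevel => c.
pose A (q : 'rV[rat]_m) :=
  [set t | g (map_mx ratr q) + L * enorm (phi t - map_mx ratr q) < c].
rewrite (_ : [set _ | _] = \bigcup_q A q).
  apply: countable_bigcupT_measurable => [|q]; first exact: countableP.
  have mq : measurable_fun setT
      (fun t => g (map_mx ratr q) + L * enorm (phi t - map_mx ratr q)).
    apply: measurable_funD => //; apply: measurable_funM => //.
    apply: measurable_enorm => j.
    under eq_fun do rewrite !mxE.
    by apply: measurable_funB.
  have := measurable_fun_ltr mq (measurable_cst c).
  by move=> /(_ measurableT [set true] I); rewrite setTI.
apply/seteqP; split => t /=; last by move=> [q _]; apply: le_lt_trans.
(* Passing from [phi t] to [q] and adding the penalty costs at most [2 * L] times their distance,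
   hence the denominator. *)
move=> gc; have k0 : 0 < 2 * L + 1 by lra.
have [q qe] : exists q : 'rV[rat]_m,
    enorm (phi t - map_mx ratr q) < (c - g (phi t)) / (2 * L + 1).
  by apply: rat_approx; rewrite divr_gt0// subr_gt0.
exists q => //; rewrite /A/=; move: qe; rewrite ltr_pdivlMr// => qe.
have := Lg (map_mx ratr q) (phi t); rewrite enormB.
have := enorm_ge0 (phi t - map_mx ratr q); nra.
Qed.

(** The integral is a difference of integrals of the positive and negative parts, and Tonelli makes
    each measurable in the parameter. *)
Lemma measurable_Rintegral_snd d (T : measurableType d) (f : T * R -> R) :
  measurable_fun setT f ->
  measurable_fun setT (fun t => Rintegral (@lebesgue_measure R) setT (fun x => f (t, x))).
Proof.
move=> mf; rewrite /Rintegral.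
apply: (@measurableT_comp _ _ _ _ _ _ fine) => //.
have mfE : measurable_fun setT (EFin \o f) by exact/measurable_EFinP.
under eq_fun do rewrite integralE.
apply: emeasurable_funB.
  apply: (eq_measurable_fun (fubini_F (@lebesgue_measure R) (EFin \o f)^\+)%E).
    by move=> t _; apply: eq_integral => x _; rewrite !funeposE.
  apply: measurable_fun_fubini_tonelli_F => //; exact: measurable_funepos.
apply: (eq_measurable_fun (fubini_F (@lebesgue_measure R) (EFin \o f)^\-)%E).
  by move=> t _; apply: eq_integral => x _; rewrite !funenegE.
apply: measurable_fun_fubini_tonelli_F => //; exact: measurable_funeneg.
Qed.

(** * Bounded integrands supported in the segment or the cube: size and additivity of [iint] *)

Local Notation segment := (`[(-1 : R)%R, 1%R]%classic).

Lemma lebesgue_segment_lty : (@lebesgue_measure R segment < +oo)%E.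
Proof. by rewrite lebesgue_measure_itv/=; case: ifP; rewrite ltry. Qed.

Lemma segment_integrable (f : R -> R) (M : R) : measurable_fun setT f ->
  (forall x, `|f x| <= M) ->
  (@lebesgue_measure R).-integrable segment (EFin \o f).
Proof.
move=> mf fM; apply: measurable_bounded_integrable => //.
- exact: lebesgue_segment_lty.
- exact: measurable_funTS.
- by exists M; split; [exact: num_real | move=> K MK x _ /=; apply: le_trans (ltW MK)].
Qed.

Lemma restrict_segment (f : R -> R) : (forall x, 1 < `|x| -> f x = 0) ->
  f \_ segment = f.
Proof.
move=> f0; apply/funext => x; rewrite patchE; case: ifPn => // xI; apply/esym/f0.
by move: xI; rewrite notin_setE/= in_itv/= -ler_norml => /negP; rewrite -ltNge.
Qed.

Lemma norm_Rintegral_segment_le (f : R -> R) (M : R) : measurable_fun setT f ->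
  (forall x, `|f x| <= M) -> (forall x, 1 < `|x| -> f x = 0) ->
  `|Rintegral (@lebesgue_measure R) setT f| <= 2 * M.
Proof.
move=> mf fM f0; rewrite -(restrict_segment _ f0) -Rintegral_mkcond.
have fi := segment_integrable _ _ mf fM.
have M0 : 0 <= M by apply: le_trans (fM 0).
apply: le_trans (le_normr_Rintegral _ fi) _ => //.
apply: (@le_trans _ _ (Rintegral (@lebesgue_measure R) segment (fun=> M))).
  apply: le_Rintegral => //; first exact: integrable_norm.
  apply: (segment_integrable (fun=> M) M) => // _; by rewrite ger0_norm.
rewrite Rintegral_cst//= lebesgue_measure_itv/= lte_fin.
by case: ifP => _ /=; rewrite mulrC; [apply: ler_wpM2r => //; lra | rewrite mul0r mulr_ge0].
Qed.

Lemma RintegralB_segment (f g : R -> R) (M N : R) :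
  measurable_fun setT f -> measurable_fun setT g ->
  (forall x, `|f x| <= M) -> (forall x, `|g x| <= N) ->
  (forall x, 1 < `|x| -> f x = 0) -> (forall x, 1 < `|x| -> g x = 0) ->
  Rintegral (@lebesgue_measure R) setT (fun x => f x - g x) =
  Rintegral (@lebesgue_measure R) setT f - Rintegral (@lebesgue_measure R) setT g.
Proof.
move=> mf mg fM gN f0 g0.
have fg0 x : 1 < `|x| -> f x - g x = 0 by move=> x1; rewrite f0// g0// subrr.
rewrite -(restrict_segment _ fg0) -[in RHS](restrict_segment _ f0) -[in RHS](restrict_segment _ g0).
rewrite -!Rintegral_mkcond RintegralB//.
- exact: (segment_integrable _ _ mf fM).
- exact: (segment_integrable _ _ mg gN).
Qed.

(** Support in the cube passes to the slices [ext x v] and confines every one-dimensional integral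
    to [segment], which has finite measure. *)
Definition cube_supported {m} (F : ('I_m -> R) -> R) :=
  forall v, (exists j, 1 < `|v j|) -> F v = 0.

Lemma ext_ord0 m (x : R) (v : 'I_m -> R) : ext x v ord0 = x.
Proof. by rewrite /ext unlift_none. Qed.

Lemma ext_lift m (x : R) (v : 'I_m -> R) j : ext x v (lift ord0 j) = v j.
Proof. by rewrite /ext liftK. Qed.

Lemma cube_supported_ext m (F : ('I_m.+1 -> R) -> R) x : cube_supported F ->
  cube_supported (fun v => F (ext x v)).
Proof.
by move=> F0 v [j vj]; apply: F0; exists (lift ord0 j); rewrite ext_lift.
Qed.

Lemma cube_supported_ext_out m (F : ('I_m.+1 -> R) -> R) x : cube_supported F ->
  1 < `|x| -> (fun v => F (ext x v)) = fun=> 0.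
Proof.
by move=> F0 x1; apply/funext => v; apply: F0; exists ord0; rewrite ext_ord0.
Qed.

Lemma iint_cst0 m : iint (fun _ : 'I_m -> R => 0) = 0.
Proof.
elim: m => //= m IH; under eq_Rintegral do rewrite IH.
by rewrite Rintegral_cst// mul0r.
Qed.

Lemma coord_measurable_ext d (T : measurableType d) m
    (F : T -> ('I_m.+1 -> R) -> R) : coord_measurable F ->
  coord_measurable (fun (tx : T * R) v => F tx.1 (ext tx.2 v)).
Proof.
move=> mF d' T' psi phi mpsi mphi.
apply: (mF _ _ (fun t => (psi t).1) (fun t => ext (psi t).2 (phi t))).
  exact: measurableT_comp.
move=> j; rewrite /ext; case: unliftP => [k _|_].
  exact: mphi.
exact: measurableT_comp.
Qed.

(** The induction enlarges the parameter space from [T] to [T * R]: the outermost integration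
    variable becomes a parameter of the inner integral. *)
Lemma measurable_iint m d (T : measurableType d) (F : T -> ('I_m -> R) -> R) :
  coord_measurable F -> measurable_fun setT (fun t => iint (F t)).
Proof.
elim: m d T F => [|m IH] d T F mF /=; first exact: (mF _ _ id (fun _ _ => 0)).
apply: (measurable_Rintegral_snd _ _ (fun tx => iint (fun v => F tx.1 (ext tx.2 v)))).
exact/IH/coord_measurable_ext.
Qed.

(** The parameter space [unit] stands for a function without parameter. *)
Lemma coord_measurable_section d (T : measurableType d) m
    (F : T -> ('I_m -> R) -> R) t : coord_measurable F ->
  coord_measurable (fun _ : unit => F t).
Proof. by move=> mF d' T' psi phi _ mphi; exact: (mF _ _ (fun=> t)). Qed.

Lemma coord_measurable_slice m (F : ('I_m.+1 -> R) -> R) :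
  coord_measurable (fun _ : unit => F) ->
  coord_measurable (fun (x : R) v => F (ext x v)).
Proof.
move=> mF d' T' psi phi mpsi mphi.
have mtt : measurable_fun setT (fun t => (tt, psi t)) by exact: measurable_fun_pair.
exact: (coord_measurable_ext _ _ _ _ mF _ _ _ _ mtt mphi).
Qed.

Lemma coord_measurable_unit m (F : ('I_m.+1 -> R) -> R) x :
  coord_measurable (fun _ : unit => F) ->
  coord_measurable (fun _ : unit => fun v => F (ext x v)).
Proof.
move=> mF; apply: (coord_measurable_section _ _ _ (fun x v => F (ext x v)) x).
exact: coord_measurable_slice.
Qed.

(** Each integration over the segment contributes its length 2. *)
Lemma norm_iint_le m (F : ('I_m -> R) -> R) M :
  coord_measurable (fun _ : unit => F) -> cube_supported F ->
  (forall v, `|F v| <= M) -> `|iint F| <= 2 ^+ m * M.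
Proof.
elim: m F => [|m IH] F mF F0 FM /=; first by rewrite mul1r.
rewrite exprS -mulrA; apply: norm_Rintegral_segment_le => [|x|x x1].
- exact: (measurable_iint _ _ _ (fun x v => F (ext x v)) (coord_measurable_slice _ _ mF)).
- apply: IH => //; [exact: coord_measurable_unit | exact: cube_supported_ext].
- by rewrite (cube_supported_ext_out _ _ _ F0 x1) iint_cst0.
Qed.

Lemma iintB m (F G : ('I_m -> R) -> R) M N :
  coord_measurable (fun _ : unit => F) -> coord_measurable (fun _ : unit => G) ->
  cube_supported F -> cube_supported G ->
  (forall v, `|F v| <= M) -> (forall v, `|G v| <= N) ->
  iint (fun v => F v - G v) = iint F - iint G.
Proof.
elim: m F G => [//|m IH] F G mF mG F0 G0 FM GN /=.
(* Additivity of the outer integral requires the inner integrals to be measurable, bounded and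
   supported in the segment. *)
have bnd (K : ('I_m.+1 -> R) -> R) L : coord_measurable (fun _ : unit => K) ->
    cube_supported K -> (forall v, `|K v| <= L) ->
    [/\ measurable_fun setT (fun x => iint (fun v => K (ext x v))),
        forall x, `|iint (fun v => K (ext x v))| <= 2 ^+ m * L &
        forall x, 1 < `|x| -> iint (fun v => K (ext x v)) = 0].
  move=> mK K0 KL; split => [|x|x x1].
  - exact: (measurable_iint _ _ _ (fun x v => K (ext x v)) (coord_measurable_slice _ _ mK)).
  - by apply: norm_iint_le => //; [exact: coord_measurable_unit | exact: cube_supported_ext].
  - by rewrite (cube_supported_ext_out _ _ _ K0 x1) iint_cst0.
have [mf fM f0] := bnd F M mF F0 FM; have [mg gN g0] := bnd G N mG G0 GN.
rewrite -(RintegralB_segment _ _ _ _ mf mg fM gN f0 g0).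
apply: eq_Rintegral => x _; apply: IH => //;
  by first [exact: coord_measurable_unit | exact: cube_supported_ext].
Qed.

End CoordMeasurable.

(** * Lipschitz dependence of the Steiner point on the set *)

Section Steiner.
Context {R : realType} {m : nat}.
Implicit Types (E : set 'rV[R]_m).

(** This is the integrand of the cone construction in [sphere_int]. At [u = 0] the inverse is [0],
    so the value is [g 0]. *)
Definition ball_ext (g : 'rV[R]_m -> R) (v : 'I_m -> R) : R :=
  let u := \row_(i < m) v i in if enorm u <= 1 then g ((enorm u)^-1 *: u) else 0.

Lemma enorm_normalize_le (u : 'rV[R]_m) : enorm ((enorm u)^-1 *: u) <= 1.
Proof.
rewrite enormZ normfV ger0_norm ?enorm_ge0//.
by have [->|u0] := eqVneq (enorm u) 0; rewrite ?mulr0// mulVf.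
Qed.

Lemma ball_ext_cube_supported g : cube_supported (ball_ext g).
Proof.
move=> v [j vj]; rewrite /ball_ext ifF//; apply/negbTE; rewrite -ltNge.
by apply: lt_le_trans vj _; have := norm_coord_le (\row_i v i) j; rewrite mxE.
Qed.

Lemma norm_ball_ext_le g M : 0 <= M -> (forall u, enorm u <= 1 -> `|g u| <= M) ->
  forall v, `|ball_ext g v| <= M.
Proof.
move=> M0 gM v; rewrite /ball_ext; case: ifP => _; rewrite ?normr0//.
exact/gM/enorm_normalize_le.
Qed.

Lemma coord_measurable_ball_ext E (rho : R) j : E !=set0 ->
  (forall y, E y -> enorm y <= rho) ->
  coord_measurable (fun _ : unit => ball_ext (fun p => p 0 j * Defs.support E p)).
Proof.
move=> E0 Er d' T' psi phi _ mphi; rewrite /ball_ext.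
have rho0 : 0 <= rho by case: E0 => y /Er; apply: le_trans; exact: enorm_ge0.
have mN : measurable_fun setT (fun t => enorm (\row_i phi t i)).
  by apply: measurable_enorm => i; under eq_fun do rewrite mxE; exact: mphi.
have mV : measurable_fun setT (fun t => (enorm (\row_i phi t i))^-1).
  under eq_fun do rewrite -powR_inv1 ?enorm_ge0//.
  exact: (measurableT_comp (measurable_powR _)).
have mu i : measurable_fun setT
    (fun t => ((enorm (\row_i phi t i))^-1 *: \row_i phi t i) 0 i).
  by under eq_fun do rewrite !mxE; apply: measurable_funM => //; exact: mphi.
apply: measurable_fun_ifT => //.
  exact: measurable_fun_ler.
apply: measurable_funM => //.
apply: (measurable_lipschitz _ _ _ _ rho) => // p q.
exact: support_lipschitz.
Qed.

(** The Steiner point is linear in the support function, and the support functions of two sets at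
    Hausdorff distance at most [D] differ by at most [D] on the unit ball. The factor [2 ^+ m] is
    the volume of the enclosing cube. *)
Lemma steiner_dist_le E E' (D rho : R) j : E !=set0 -> E' !=set0 -> 0 <= D ->
  (forall y, E y -> enorm y <= rho) -> (forall y, E' y -> enorm y <= rho) ->
  (forall y, E y -> exists2 w, E' w & enorm (w - y) <= D) ->
  (forall y, E' y -> exists2 w, E w & enorm (w - y) <= D) ->
  `|steiner E 0 j - steiner E' 0 j| <=
    m%:R * (2 ^+ m * `|(ball_int (fun _ : 'rV[R]_m => 1))^-1|) * D.
Proof.
move=> E0 E'0 D0 Er E'r EE' E'E.
rewrite !mxE -mulrBr normrM normr_nat -!mulrA ler_wpM2l//.
rewrite /sphere_int -mulrBl normrM mulrCA mulrC ler_wpM2l//.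
rewrite /ball_int -!/(ball_ext _).
have rho0 : 0 <= rho by case: E0 => y /Er; apply: le_trans; exact: enorm_ge0.
have bnd K : K !=set0 -> (forall y, K y -> enorm y <= rho) ->
    forall v, `|ball_ext (fun p => p 0 j * Defs.support K p) v| <= rho.
  move=> K0 Kr; apply: norm_ball_ext_le => // u u1; rewrite normrM.
  rewrite -[leRHS]mul1r ler_pM//; first exact: le_trans (norm_coord_le _ _) u1.
  by apply: le_trans (norm_support_le _ _ _ K0 Kr) _; rewrite ler_piMr.
have mE := coord_measurable_ball_ext _ _ j E0 Er.
have mE' := coord_measurable_ball_ext _ _ j E'0 E'r.
rewrite -(iintB _ _ _ _ _ mE mE' (ball_ext_cube_supported _)
  (ball_ext_cube_supported _) (bnd _ E0 Er) (bnd _ E'0 E'r)).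
apply: norm_iint_le.
- move=> d' T' psi phi mpsi mphi; apply: measurable_funB.
    exact: (mE _ _ _ _ mpsi mphi).
  exact: (mE' _ _ _ _ mpsi mphi).
- by move=> v vj; rewrite !ball_ext_cube_supported// subrr.
move=> v; rewrite /ball_ext; case: ifP => _; last by rewrite subrr normr0.
set p := _ *: _; have p1 : enorm p <= 1 := enorm_normalize_le _.
rewrite -mulrBr normrM -[leRHS]mul1r ler_pM//.
  exact: le_trans (norm_coord_le _ _) p1.
have Dp : D * enorm p <= D by rewrite ler_piMr.
have := support_le E E' p D rho E0 E'r EE'; have := support_le E' E p D rho E'0 Er E'E.
by rewrite ler_norml => h1 h2; apply/andP; split; lra.
Qed.

End Steiner.


(** * From close convex functions to close Steiner points *)

Section Approximation.
Context {R : realType}.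

(** The distances from [a] differ by at most [dl], so a point of [E'] within [dl] of [y] leaves the
    ball of [E'] by at most [3 * dl]. Pulling it back costs [21 * dl] more. *)
Lemma truncate_subset_approx m (E E' : set 'rV[R]_m) (a : 'rV[R]_m) (D rho dl : R) :
  E !=set0 -> E' !=set0 -> (dist_set a E' = 0 -> E' a) ->
  (forall y z l, 0 <= l <= 1 -> E' y -> E' z -> E' (l *: y + (1 - l) *: z)) ->
  0 < dl -> dist_set a E <= D -> dist_set a E' <= D -> enorm a + 2 * D + 1 <= rho ->
  (forall y, E y -> enorm y <= rho -> exists2 y', E' y' & enorm (y' - y) <= dl) ->
  (forall y, E' y -> enorm y <= rho -> exists2 y', E y' & enorm (y' - y) <= dl) ->
  forall y, truncate E a y -> exists2 w, truncate E' a w & enorm (w - y) <= 22 * dl.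
Proof.
move=> E0 E'0 clE' cE' dl0 dD d'D aD EE' E'E y [Ey ya].
have d0 := dist_set_ge0 E a E0; have d'0 := dist_set_ge0 E' a E'0.
have bnd (u : 'rV[R]_m) : enorm u <= enorm (u - a) + enorm a.
  by rewrite -{1}(subrK a u); exact: enormD.
have dd' : dist_set a E <= dist_set a E' + dl.
  apply/ler_addgt0Pr => e e0.
  (* Capping the slack at 1 keeps the near-minimizer [z] in the ball of radius [rho], where [E'E]
     applies. *)
  have me0 : 0 < Num.min e 1 by rewrite lt_min e0 ltr01.
  have [_ [z E'z <-]] := inf_adherent me0 (has_inf_dist E' a E'0).
  rewrite -/(dist_set a E') => az.
  have e1 : Num.min e 1 <= 1 by rewrite ge_min lexx orbT.
  have ee : Num.min e 1 <= e by rewrite ge_min lexx.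
  have zr : enorm z <= rho.
    by apply: le_trans (bnd z) _; rewrite enormB; lra.
  have [w Ew wz] := E'E z E'z zr.
  apply: le_trans (dist_set_le E a w Ew) _.
  have := enormD (a - z) (z - w); rewrite subrKA (enormB z); lra.
have [y' E'y' y'y] : exists2 y', E' y' & enorm (y' - y) <= dl.
  by apply: EE' => //; apply: le_trans (bnd y) _; lra.
have y'a : enorm (y' - a) <= 2 * dist_set a E' + 3 * dl.
  by have := enormD (y' - y) (y - a); rewrite subrKA; lra.
have [w tw wy'] := truncate_approx E' a y' dl E'0 clE' cE' dl0 E'y' y'a.
by exists w => //; have := enormD (w - y') (y' - y); rewrite subrKA; lra.
Qed.

Context {n : nat}.
Implicit Types (g : 'rV[R]_n -> R) (a z : 'rV[R]_n.+1).

(** The sandwich applied to [g - g 0] yields a minorant touching [g] at [0] with slope at most [c].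
    It gives a bound on the distance to the epigraph that is uniform in the state variable. *)
Lemma epi_conj_point g (c : R) : convexf g -> 0 <= c ->
  (forall p, `|g p - g 0| <= c * enorm p) ->
  exists2 z, epi_conj g z & enorm z <= c + `|g 0|.
Proof.
move=> cg c0 gc.
have [||p|w wc wg] := sandwich_linear (fun p => g p - g 0) c.
- by move=> p q l l01; have := cg p q l l01; lra.
- by [].
- by have := gc p; rewrite ler_norml => /andP[h _]; rewrite mulNr.
exists (pairv w (- g 0)).
  by move=> p; rewrite firstn_pairv lastc_pairv; have := wg p; lra.
apply: le_trans (enorm_le_split _) _.
by rewrite firstn_pairv lastc_pairv normrN lerD2r.
Qed.

Lemma steiner_truncate_epi_approx g g' (P e M r rho0 dl : R) a z j :
  convexf g -> convexf g' -> 0 < P -> 0 <= e ->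
  (forall p, enorm p <= P -> `|g' p - g p| <= e) -> `|g 0| <= M -> `|g' 0| <= M ->
  enorm a <= r -> epi_conj g z -> enorm z <= rho0 -> 0 < dl -> dl <= 1 ->
  (M + (3 * r + 2 * rho0 + 3) + e) / P + e <= dl ->
  `|steiner (truncate (epi_conj g') a) 0 j - steiner (truncate (epi_conj g) a) 0 j| <=
    n.+1%:R * (2 ^+ n.+1 * `|(ball_int (fun _ : 'rV[R]_n.+1 => 1))^-1|) * (22 * dl).
Proof.
move=> cg cg' P0 e0 gg' gM g'M ar Ez zr dl0 dl1 dlP.
(* This equals [r + 2 * D + 1] with [D = r + rho0 + 1], a bound on both distances. The 1 inside [D]
   absorbs the gap [dl <= 1] between [z] and its approximation [z']. *)
set rho := 3 * r + 2 * rho0 + 3 in dlP.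
have r0 : 0 <= r := le_trans (enorm_ge0 _) ar.
have rho00 : 0 <= rho0 := le_trans (enorm_ge0 _) zr.
have EE' y : epi_conj g y -> enorm y <= rho ->
    exists2 y', epi_conj g' y' & enorm (y' - y) <= dl.
  move=> Ey yr.
  have [|p pP|y' E'y' y'y] := epi_conj_approx g g' P e rho M y cg' P0 e0 _ _ Ey yr.
  - by apply: le_trans g'M; exact: ler_norm.
  - by have := gg' p pP; rewrite ler_norml => /andP[h _]; lra.
  - by exists y' => //; exact: le_trans dlP.
have E'E y : epi_conj g' y -> enorm y <= rho ->
    exists2 y', epi_conj g y' & enorm (y' - y) <= dl.
  move=> Ey yr.
  have [|p pP|y' E'y' y'y] := epi_conj_approx g' g P e rho M y cg P0 e0 _ _ Ey yr.
  - by apply: le_trans gM; exact: ler_norm.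
  - by have := gg' p pP; rewrite ler_norml => /andP[_ h]; lra.
  - by exists y' => //; exact: le_trans dlP.
have [z' E'z' z'z] : exists2 z', epi_conj g' z' & enorm (z' - z) <= dl.
  by apply: EE' => //; rewrite /rho; lra.
have E0 : epi_conj g !=set0 by exists z.
have E'0 : epi_conj g' !=set0 by exists z'.
have dE : dist_set a (epi_conj g) <= r + rho0 + 1.
  apply: le_trans (dist_set_le _ a z Ez) _.
  by have := enormD a (- z); rewrite enormN; lra.
have dE' : dist_set a (epi_conj g') <= r + rho0 + 1.
  apply: le_trans (dist_set_le _ a z' E'z') _.
  have := enormD a (- z'); have := enormD (z' - z) z.
  by rewrite enormN subrK; lra.
have arho : enorm a + 2 * (r + rho0 + 1) + 1 <= rho by rewrite /rho; lra.
have bnd E y : dist_set a E <= r + rho0 + 1 -> truncate E a y -> enorm y <= rho.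
  move=> dD [_ ya]; have := enormD (y - a) a; rewrite subrK; lra.
have ne g1 : epi_conj g1 !=set0 -> truncate (epi_conj g1) a !=set0.
  move=> E1; have [y Ey ya] := near_minimizer _ a E1 (epi_conj_dist0 g1 a E1).
  by exists y; split=> //; have := dist_set_ge0 _ a E1; lra.
apply: (steiner_dist_le _ _ _ rho).
- exact: ne.
- exact: ne.
- by rewrite mulr_ge0// ltW.
- by move=> y; exact: bnd.
- by move=> y; exact: bnd.
- apply: (truncate_subset_approx _ _ _ _ _ rho _ E'0 E0 _ _ dl0 dE' dE) => //.
  + exact: epi_conj_dist0.
  + by move=> *; exact: epi_conj_convex.
- apply: (truncate_subset_approx _ _ _ _ _ rho _ E0 E'0 _ _ dl0 dE dE') => //.
  + exact: epi_conj_dist0.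
  + by move=> *; exact: epi_conj_convex.
Qed.

Lemma compact_normB m (r : R) : compact [set u : 'rV[R]_m | `|u| <= r].
Proof.
apply: bounded_closed_compact.
  exists r; split; first exact: num_real.
  by move=> s rs u ur; exact: le_trans ur (ltW rs).
apply: (@closed_comp _ _ (fun u : 'rV[R]_m => `|u|) [set s | s <= r]).
  by move=> u _; exact: norm_continuous.
exact: closed_le.
Qed.

End Approximation.

(** * Choice of constants at a fixed time, and conclusion *)

Theorem theorem4p3 (R : realType) (n : nat) (T : R)
    (Hs : nat -> R -> 'rV[R]_n -> 'rV[R]_n -> R)
    (H : R -> 'rV[R]_n -> 'rV[R]_n -> R) :
  (forall i, hyps T (Hs i)) -> hyps T H ->
  (forall t, t \in `[0, T] ->
     forall K : set ('rV[R]_n * 'rV[R]_n), compact K ->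
     forall eps : R, 0 < eps -> exists N : nat, forall i, (N <= i)%N ->
       forall xp, K xp -> `|Hs i t xp.1 xp.2 - H t xp.1 xp.2| < eps) ->
  forall t, t \in `[0, T] ->
    forall K : set ('rV[R]_n * 'rV[R]_n.+1), compact K ->
    forall eps : R, 0 < eps -> exists N : nat, forall i, (N <= i)%N ->
      forall xa, K xa ->
        enorm (fH (Hs i) t xa.1 xa.2 - fH H t xa.1 xa.2) < eps /\
        `|lH (Hs i) t xa.1 xa.2 - lH H t xa.1 xa.2| < eps.
Proof.
move=> hypHs [_ _ H3 [c [_ H4]] HLC] cvgH t tT K cK eps eps0.
have [r r0 Kr] : exists2 r : R, 0 < r &
    forall xa, K xa -> enorm xa.1 <= r /\ enorm xa.2 <= r.
  have [M [_ KM]] := compact_bounded cK.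
  have M1 : 0 < `|M| + 1 by rewrite ltr_pwDr.
  (* The dimension factor converts the max-norm bound into a Euclidean one for both components. *)
  exists (n.+1%:R * (`|M| + 1)) => [|[x a] Kxa]; first by rewrite mulr_gt0.
  have := KM (`|M| + 1) _ _ Kxa; rewrite ltr_pwDr ?ler_norm// => /(_ isT).
  rewrite /= prod_normE ge_max => /andP[xM aM].
  split; apply: le_trans (enorm_le_norm _) _; apply: ler_pM => //.
  by rewrite ler_nat.
have [c0 Hc] := H4 t tT.
have [k [_ /(_ t tT)[k0 Hk]]] := HLC r r0.
(* (HLC) between [x] and [0], at momentum [0], bounds [H t x 0] for all [x] in the ball of radius
   [r]. *)
pose M0 := `|H t 0 0| + k t * r.
have HM0 x : enorm x <= r -> `|H t x 0| <= M0.
  move=> xr; have := Hk x 0 0 xr; rewrite enorm0 addr0 mulr1 subr0 => /(_ (ltW r0)).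
  have : k t * enorm x <= k t * r by rewrite ler_wpM2l.
  have := ler_normD (H t x 0 - H t 0 0) (H t 0 0); rewrite subrK /M0; lra.
have M00 : 0 <= M0 by rewrite addr_ge0// mulr_ge0// ltW.
pose rho0 := c t * (1 + r) + M0.
have rho00 : 0 <= rho0 by rewrite addr_ge0// mulr_ge0//; lra.
pose C : R := n.+1%:R * (2 ^+ n.+1 * `|(ball_int (fun _ : 'rV[R]_n.+1 => 1))^-1|).
have C0 : 0 <= C by rewrite !mulr_ge0// exprn_ge0.
(* Each of the [n.+1] coordinates contributes an error [C * (22 * dl)]. *)
pose X := n.+1%:R * (C * 22).
have X0 : 0 <= X by rewrite !mulr_ge0.
have X1 : 0 < X + 1 by lra.
pose dl := Num.min 1 (eps / (X + 1)).
have dl0 : 0 < dl by rewrite lt_min ltr01 divr_gt0.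
have dl1 : dl <= 1 by rewrite ge_min lexx.
have Xdl : X * dl < eps.
  have : dl * (X + 1) <= eps by rewrite -ler_pdivlMr// ge_min lexx orbT.
  lra.
have dl20 : 0 < dl / 2 by rewrite divr_gt0.
pose B := M0 + 1 + (3 * r + 2 * rho0 + 3) + dl / 2.
have B0 : 0 < B by rewrite /B; lra.
(* With this radius [B / P] is [dl / 2]; the closeness [dl / 2] of the Hamiltonians supplies the
   other half of [dl]. *)
pose P := B / (dl / 2).
have P0 : 0 < P by rewrite !divr_gt0.
(* Convergence is used on a product of max-norm balls, which contain the Euclidean balls of radii
   [r] and [P]. *)
have [N HN] := cvgH t tT _ (compact_setX (compact_normB n r) (compact_normB n P))
  (dl / 2) dl20.
exists N => i Ni [x a] Kxa /=.
have /= [xr ar] := Kr _ Kxa.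
have [_ _ Hs3 _ _] := hypHs i.
have close p : enorm p <= P -> `|Hs i t x p - H t x p| <= dl / 2.
  move=> pP; apply/ltW/(HN i Ni (x, p)); split => /=.
    exact: le_trans (norm_le_enorm _) xr.
  exact: le_trans (norm_le_enorm _) pP.
have [z Ez zr] : exists2 z, epi_conj (H t x) z & enorm z <= rho0.
  have [|p|z Ez zr] := epi_conj_point (H t x) (c t * (1 + r)) (H3 t tT x).
  - by rewrite mulr_ge0//; lra.
  - apply: le_trans (Hc x p 0) _; rewrite subr0 ler_wpM2r ?enorm_ge0//.
    by rewrite ler_wpM2l// lerD2l.
  - by exists z => //; apply: le_trans zr _; rewrite lerD2l HM0.
have HsM : `|Hs i t x 0| <= M0 + 1.
  have := close 0; rewrite enorm0 => /(_ (ltW P0)).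
  have := ler_normD (Hs i t x 0 - H t x 0) (H t x 0); have := HM0 x xr.
  by rewrite subrK; lra.
have eHE F : eH F t x a = steiner (truncate (epi_conj (F t x)) a).
  by rewrite /eH /PhiH epiHE.
have e_lt : enorm (eH (Hs i) t x a - eH H t x a) < eps.
  apply: le_lt_trans Xdl; apply: le_trans (enorm_le_sum _) _.
  have -> : X * dl = \sum_(j < n.+1) C * (22 * dl).
    by rewrite sumr_const card_ord -[RHS]mulr_natl /X !mulrA.
  apply: ler_sum => j _; rewrite !eHE mxE [X in _ + X]mxE.
  apply: (steiner_truncate_epi_approx _ _ P (dl / 2) (M0 + 1) r rho0 dl a z j) => //.
  - exact: H3.
  - exact: Hs3.
  - by lra.
  - by have := HM0 x xr; lra.
  - rewrite -/B /P invf_div mulrA mulrAC divff ?gt_eqF// mul1r; lra.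
split.
  by apply: le_lt_trans e_lt; rewrite -firstnB enorm_firstn_le.
by apply: le_lt_trans e_lt; rewrite -lastcB norm_lastc_le.
Qed.
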